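(* Let $R$ be a right Ore domain and let $\widetilde{R_R}$ be the completion of $R_R$ in the $R$-topology. Then $\widetilde{R_R}$ is a strongly flat right $R$-module.
   Context: Rings are associative with identity, not necessarily commutative; a domain is a ring without non-zero zero-divisors. $R$ is a right Ore domain if $S:=R\setminus\{0\}$ is a right Ore set; $Q:=R[S^{-1}]$ is then the classical right quotient ring of $R$ (its elements have the form $as^{-1}$ with $a\in R$, $s\in S$), a division ring containing $R$. The $R$-topology on $R_R$ is the linear topology having as a neighborhood base of $0$ the right ideals $U(s_1,\dots,s_n):=\{x\in R\mid xR\subseteq Rs_1\cap\dots\cap Rs_n\}$, where $\{s_1,\dots,s_n\}$ ranges over the non-empty finite subsets of $S$. The (Hausdorff) completion is the right $R$-module $\widetilde{R_R}:=\varprojlim R/U(s_1,\dots,s_n)$. A right $R$-module $M_R$ is Matlis-cotorsion if $\operatorname{Ext}^1_R(Q_R,M_R)=0$. A right $R$-module $A_R$ is strongly flat if $\operatorname{Ext}^1_R(A_R,M_R)=0$ for every Matlis-cotorsion right $R$-module $M_R$. *)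

(* Defs.v *)
From HB Require Import structures.
From mathcomp Require Import all_boot all_algebra.
From mathcomp Require Import generic_quotient ring_quotient finmap.
From mathcomp Require Import boolp.

Set Implicit Arguments.
Unset Strict Implicit.
Unset Printing Implicit Defensive.

Import GRing.Theory.
Local Open Scope ring_scope.
Local Open Scope quotient_scope.

(* A right R-module is a left module over the converse ring: v r is written
   r *: v with r : R^c.  The right module R_R is R^c^o, whose scaling is
   r *: x = x * r. *)
Notation right_module R := (lmodType R^c).

Definition domain (R : nzRingType) : Prop :=
  forall x y : R, x * y = 0 -> x = 0 \/ y = 0.

Definition right_Ore_set (R : nzRingType) (S : R -> Prop) : Prop :=
  [/\ S 1, forall s t, S s -> S t -> S (s * t)
    & forall a s, S s -> exists b t, S t /\ a * t = s * b].

Definition right_Ore_domain (R : nzRingType) : Prop :=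
  domain R /\ right_Ore_set (fun s : R => s <> 0).

(* This determines Q up to a unique isomorphism under R. *)
Definition classical_right_quotient_ring (R : nzRingType) (Q : unitRingType)
    (iota : {rmorphism R -> Q}) : Prop :=
  [/\ injective iota, forall s, s <> 0 -> iota s \is a GRing.unit
    & forall q, exists a s, s <> 0 /\ q = iota a * (iota s)^-1].

Definition as_right_module (R Q : nzRingType) (iota : {rmorphism R -> Q}) : Type
  := Q.

Section AsRightModule.
Variables (R Q : nzRingType) (iota : {rmorphism R -> Q}).

HB.instance Definition _ := GRing.Zmodule.copy (as_right_module iota) Q.

Definition as_right_module_scale (r : R^c) (q : as_right_module iota)
  : as_right_module iota := (q : Q) * iota r.

Fact as_right_module_scaleA a b v :
  as_right_module_scale a (as_right_module_scale b v)
  = as_right_module_scale (a * b) v.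
Proof. by rewrite /as_right_module_scale -mulrA -rmorphM. Qed.

Fact as_right_module_scale1 : left_id 1 as_right_module_scale.
Proof. by move=> v; rewrite /as_right_module_scale rmorph1 mulr1. Qed.

Fact as_right_module_scaleDr : right_distributive as_right_module_scale +%R.
Proof. by move=> a u v; rewrite /as_right_module_scale mulrDl. Qed.

Fact as_right_module_scaleDl v :
  {morph as_right_module_scale^~ v : a b / a + b}.
Proof. by move=> a b; rewrite /as_right_module_scale rmorphD mulrDr. Qed.

HB.instance Definition _ :=
  GRing.Zmodule_isLmodule.Build R^c (as_right_module iota)
    as_right_module_scaleA as_right_module_scale1
    as_right_module_scaleDr as_right_module_scaleDl.

End AsRightModule.

(* Ext^1 in the sense of Yoneda: classes of extensions 0 -> M -> E -> A -> 0,
   the zero class being that of the split extension. *)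
Section Extensions.
Variables (K : pzRingType) (A M : lmodType K).

Record extension := Extension {
  ext_middle :> lmodType K;
  ext_incl : {linear M -> ext_middle};
  ext_proj : {linear ext_middle -> A};
  ext_incl_inj : injective ext_incl;
  ext_proj_surj : forall a, exists e, ext_proj e = a;
  ext_exact : forall e, ext_proj e = 0 <-> exists m, ext_incl m = e
}.

Definition extension_equiv (E E' : extension) : Prop :=
  exists phi : {linear E -> E'},
    (forall m, phi (ext_incl E m) = ext_incl E' m)
    /\ (forall e, ext_proj E' (phi e) = ext_proj E e).

Definition split_incl (m : M) : (M * A)%type := (m, 0).
Definition split_proj (e : (M * A)%type) : A := e.2.

Fact split_incl_linear : linear split_incl.
Proof. by move=> a u v; congr pair; rewrite /= scaler0 addr0. Qed.
HB.instance Definition _ :=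
  GRing.isLinear.Build K M (M * A)%type *:%R split_incl split_incl_linear.

Fact split_proj_linear : linear split_proj.
Proof. by []. Qed.
HB.instance Definition _ :=
  GRing.isLinear.Build K (M * A)%type A *:%R split_proj split_proj_linear.

Fact split_incl_inj : injective split_incl.
Proof. by move=> u v []. Qed.

Fact split_proj_surj a : exists e, split_proj e = a.
Proof. by exists (0, a). Qed.

Fact split_exact e : split_proj e = 0 <-> exists m, split_incl m = e.
Proof.
case: e => m a; split; first by rewrite /split_proj /= => ->; exists m.
by case=> u [_ <-].
Qed.

Definition split_extension : extension :=
  Extension split_incl_inj split_proj_surj split_exact.

Definition Ext1_vanishes : Prop :=
  forall E : extension, extension_equiv E split_extension.

End Extensions.

Definition Matlis_cotorsion (R Q : nzRingType) (iota : {rmorphism R -> Q})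
    (M : right_module R) : Prop :=
  Ext1_vanishes (as_right_module iota) M.

Definition strongly_flat (R Q : nzRingType) (iota : {rmorphism R -> Q})
    (A : right_module R) : Prop :=
  forall M : right_module R, Matlis_cotorsion iota M -> Ext1_vanishes A M.

Section QuotientModule.
Variables (K : pzRingType) (V : lmodType K) (W : submodClosed V).

Fact submodClosed_oppr : oppr_closed W.
Proof. by move=> v Wv; rewrite -scaleN1r rpredZ. Qed.

Definition submod_zmodClosed : zmodClosed V :=
  HB.pack_for (zmodClosed V) (GRing.SubmodClosed.sort W)
    (GRing.isOppClosed.Build V W submodClosed_oppr)
    (GRing.SubmodClosed.class W).

Definition quotmod : Type := Quotient.quot submod_zmodClosed.
HB.instance Definition _ := GRing.Zmodule.on quotmod.
HB.instance Definition _ := EqQuotient.on quotmod.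

Definition quotmod_class (v : V) : quotmod :=
  \pi_(Quotient.quot submod_zmodClosed) v.

Fact quotmod_class_eqP v w :
  reflect (quotmod_class v = quotmod_class w) (v - w \in W).
Proof.
rewrite -[_ \in _]/(v - w \in submod_zmodClosed) Quotient.idealrBE.
exact: eqP.
Qed.

Fact quotmod_class_repr (x : quotmod) : quotmod_class (repr x) = x.
Proof. exact: reprK. Qed.

Fact quotmod_classD : {morph quotmod_class : v w / v + w}.
Proof. by move=> v w; rewrite /quotmod_class !piE. Qed.

Definition quotmod_scale (a : K) (x : quotmod) : quotmod :=
  quotmod_class (a *: repr x).

Fact quotmod_scale_class a v :
  quotmod_scale a (quotmod_class v) = quotmod_class (a *: v).
Proof.
apply/quotmod_class_eqP; rewrite -scalerBr rpredZ //.
by apply/quotmod_class_eqP; rewrite quotmod_class_repr.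
Qed.

Fact quotmod_scaleA a b x :
  quotmod_scale a (quotmod_scale b x) = quotmod_scale (a * b) x.
Proof. by rewrite -[x]quotmod_class_repr !quotmod_scale_class scalerA. Qed.

Fact quotmod_scale1 : left_id 1 quotmod_scale.
Proof.
by move=> x; rewrite -[x]quotmod_class_repr quotmod_scale_class scale1r.
Qed.

Fact quotmod_scaleDr : right_distributive quotmod_scale +%R.
Proof.
move=> a x y; rewrite -[x]quotmod_class_repr -[y]quotmod_class_repr.
by rewrite -quotmod_classD !quotmod_scale_class scalerDr quotmod_classD.
Qed.

Fact quotmod_scaleDl x : {morph quotmod_scale^~ x : a b / a + b}.
Proof.
move=> a b; rewrite -[x]quotmod_class_repr !quotmod_scale_class.
by rewrite scalerDl quotmod_classD.
Qed.

HB.instance Definition _ :=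
  GRing.Zmodule_isLmodule.Build K quotmod
    quotmod_scaleA quotmod_scale1 quotmod_scaleDr quotmod_scaleDl.

Fact quotmod_class_linear : linear quotmod_class.
Proof. by move=> a u v; rewrite quotmod_classD -quotmod_scale_class. Qed.
HB.instance Definition _ :=
  GRing.isLinear.Build K V quotmod *:%R quotmod_class quotmod_class_linear.

End QuotientModule.

(* The canonical map V/W -> V/W'; it is only meaningful when W is contained in
   W', see quotmod_trans_class. *)
Definition quotmod_trans (K : pzRingType) (V : lmodType K)
    (W W' : submodClosed V) (x : quotmod W) : quotmod W' :=
  quotmod_class W' (repr x).

Fact quotmod_trans_class (K : pzRingType) (V : lmodType K)
    (W W' : submodClosed V) :
  {subset W <= W'} ->
  forall v, quotmod_trans W' (quotmod_class W v) = quotmod_class W' v.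
Proof.
move=> sWW' v; apply/quotmod_class_eqP/sWW'/quotmod_class_eqP.
exact: quotmod_class_repr.
Qed.

Fact quotmod_trans_linear (K : pzRingType) (V : lmodType K)
    (W W' : submodClosed V) :
  {subset W <= W'} -> linear (@quotmod_trans K V W W').
Proof.
move=> sWW' a x y; rewrite -[x]quotmod_class_repr -[y]quotmod_class_repr.
by rewrite -linearP !quotmod_trans_class // linearP.
Qed.

Definition prodmod (K : pzRingType) (I : Type) (M : I -> lmodType K) : Type :=
  forall i, M i.

Section ProductModule.
Variables (K : pzRingType) (I : Type) (M : I -> lmodType K).
Implicit Types f g h : prodmod M.

HB.instance Definition _ := gen_eqMixin (prodmod M).
HB.instance Definition _ := gen_choiceMixin (prodmod M).

Definition prodmod_zero : prodmod M := fun=> 0.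
Definition prodmod_opp f : prodmod M := fun i => - f i.
Definition prodmod_add f g : prodmod M := fun i => f i + g i.
Definition prodmod_scale (a : K) f : prodmod M := fun i => a *: f i.

Fact prodmod_addA : associative prodmod_add.
Proof. by move=> f g h; apply: functional_extensionality_dep => i; apply: addrA. Qed.
Fact prodmod_addC : commutative prodmod_add.
Proof. by move=> f g; apply: functional_extensionality_dep => i; apply: addrC. Qed.
Fact prodmod_add0 : left_id prodmod_zero prodmod_add.
Proof. by move=> f; apply: functional_extensionality_dep => i; apply: add0r. Qed.
Fact prodmod_addN : left_inverse prodmod_zero prodmod_opp prodmod_add.
Proof. by move=> f; apply: functional_extensionality_dep => i; apply: addNr. Qed.

HB.instance Definition _ := GRing.isZmodule.Build (prodmod M)
  prodmod_addA prodmod_addC prodmod_add0 prodmod_addN.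

Fact prodmod_scaleA a b f :
  prodmod_scale a (prodmod_scale b f) = prodmod_scale (a * b) f.
Proof. by apply: functional_extensionality_dep => i; apply: scalerA. Qed.
Fact prodmod_scale1 : left_id 1 prodmod_scale.
Proof. by move=> f; apply: functional_extensionality_dep => i; apply: scale1r. Qed.
Fact prodmod_scaleDr : right_distributive prodmod_scale +%R.
Proof.
by move=> a f g; apply: functional_extensionality_dep => i; apply: scalerDr.
Qed.
Fact prodmod_scaleDl f : {morph prodmod_scale^~ f : a b / a + b}.
Proof.
by move=> a b; apply: functional_extensionality_dep => i; apply: scalerDl.
Qed.

HB.instance Definition _ := GRing.Zmodule_isLmodule.Build K (prodmod M)
  prodmod_scaleA prodmod_scale1 prodmod_scaleDr prodmod_scaleDl.

End ProductModule.

Section Completion.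
Variable R : nzRingType.

(* x R is contained in the intersection of the left ideals R s, s in F. *)
Definition U (F : {fset R}) : {pred R^c^o} := fun x : R =>
  `[< forall r s : R, s \in F -> exists t : R, x * r = t * s >].

(* U F is a right ideal. *)
Fact U_submod_closed (F : {fset R}) : submod_closed (U F).
Proof.
split=> [|a x y /asboolP Ux /asboolP Uy]; apply/asboolP => r s Fs.
  by exists 0; rewrite !mul0r.
have [t et] := Ux ((a : R) * r) s Fs; have [t' et'] := Uy r s Fs.
exists (t + t'); rewrite -[LHS]/(((x : R) * a + y) * r) !mulrDl -mulrA.
by rewrite -et -et'.
Qed.

HB.instance Definition _ (F : {fset R}) :=
  GRing.isSubmodClosed.Build R^c R^c^o (U F)
    (GRing.submod_closed_semi (U_submod_closed F)).

Definition finite_index : Type :=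
  {F : {fset R} | (F != fset0)%fset && (0 \notin F)}.

Definition R_mod_U (F : finite_index) : right_module R :=
  quotmod [the submodClosed R^c^o of U (val F)].

Fact U_anti (F G : {fset R}) : (F `<=` G)%fset -> {subset U G <= U F}.
Proof.
move=> /fsubsetP sFG x /asboolP Ux; apply/asboolP => r s /sFG; exact: Ux.
Qed.

Definition R_mod_U_trans (F G : finite_index) : R_mod_U G -> R_mod_U F :=
  @quotmod_trans _ _ _ _.

Fact R_mod_U_trans_linear (F G : finite_index) :
  (val F `<=` val G)%fset -> linear (@R_mod_U_trans F G).
Proof. by move=> sFG; apply/quotmod_trans_linear/U_anti. Qed.

(* The inverse limit of the modules R / U F, as a submodule of their product. *)
Definition coherent (x : prodmod R_mod_U) : bool :=
  `[< forall F G : finite_index, (val F `<=` val G)%fset ->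
        R_mod_U_trans F (x G) = x F >].

Fact coherent_submod_closed : submod_closed coherent.
Proof.
split=> [|a x y /asboolP cx /asboolP cy]; apply/asboolP => F G sFG.
  have := R_mod_U_trans_linear sFG (-1) 0 0.
  by rewrite !scaleN1r !addNr.
have := R_mod_U_trans_linear sFG a (x G) (y G).
by rewrite (cx F G sFG) (cy F G sFG).
Qed.

HB.instance Definition _ :=
  GRing.isSubmodClosed.Build R^c (prodmod R_mod_U) coherent
    (GRing.submod_closed_semi coherent_submod_closed).

Record completion := Completion {
  completion_val :> prodmod R_mod_U;
  _ : completion_val \in coherent
}.

HB.instance Definition _ := [isSub for completion_val].
HB.instance Definition _ := [Choice of completion by <:].
HB.instance Definition _ := [SubChoice_isSubLmodule of completion by <:].

End Completion.

(* Main.v *)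
Require Import Defs.
From HB Require Import structures.
From mathcomp Require Import all_boot all_algebra.
From mathcomp Require Import generic_quotient finmap.
From mathcomp Require Import boolp classical_sets.

Set Implicit Arguments.
Unset Strict Implicit.
Unset Printing Implicit Defensive.

Import GRing.Theory.
Local Open Scope ring_scope.

(** Write A for the completion of R_R and u for the image of 1 in A.  The heart
    of the matter is that A is torsion-free and that A/uR is torsion-free and
    divisible, that is, a vector space over the division ring Q
    ([completion_has_divisible_quotient]).

    The right ideals U F are in fact two-sided.  If some U F is zero, then the
    topology is discrete and A = uR.  Otherwise, for every r <> 0 and every F,
    take a nonzero t in U F: if G contains F, r and t r, then each y in U G is a
    left multiple of t r, so U G lies in (U F) r ([U_mul_refine]).  Hence
    elements that are divisible by r modulo U G can be divided by r
    coherently.  Given x in A, subtract from x an element a of R representing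
    x modulo U {r}: what remains lies in A r, so A = uR + A r and A/uR is
    divisible.  The same refinement shows that A and A/uR are torsion-free.

    A torsion-free divisible module D is strongly flat
    ([torsion_free_divisible_strongly_flat]).  Let M be Matlis-cotorsion and
    0 -> M -> E -> D -> 0 exact.  For each d in D, the pullback of E along
    Q -> D, q |-> d q, splits, so this map lifts to h : Q -> E
    ([lift_rank1]).  By Zorn's lemma there is a maximal submodule N of E that
    meets M trivially and whose image in D is a Q-subspace; if some d were not in
    this image, then N + h(Q) would be larger.  So E = M + N is a direct sum.

    Finally, if u <> 0, then uR is free and an extension of A by M induces one of
    A/uR by M, whose retraction onto M also splits the first one
    ([Ext1_vanishes_cyclic_quotient]).  If u = 0, which happens when R is a
    division ring, then A itself is torsion-free and divisible. *)

(** * Extensions and their splittings *)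

Section Modules.
Variable K : pzRingType.

Lemma linear_bundle (U V : lmodType K) (f : U -> V) :
  linear f -> exists g : {linear U -> V}, forall x, g x = f x.
Proof.
move=> flin; pose L := GRing.isLinear.Build K U V *:%R f flin.
by exists (HB.pack_for {linear U -> V} f L).
Qed.

(** A predicate proved to be closed, bundled as a submodule. *)
Definition submodClosed_of (V : lmodType K) (W : {pred V})
    (Wc : submod_closed W) : submodClosed V :=
  HB.pack_for (submodClosed V) W
    (GRing.isSubmodClosed.Build K V W (GRing.submod_closed_semi Wc)).

(** A submodule W of V as a module in its own right. *)
Record submod (V : lmodType K) (W : submodClosed V) := Submod {
  submod_val :> V;
  _ : submod_val \in W
}.

Section Submodule.
Variables (V : lmodType K) (W : submodClosed V).
HB.instance Definition _ := [isSub for @submod_val V W].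
HB.instance Definition _ := [Choice of submod W by <:].
HB.instance Definition _ := [SubChoice_isSubLmodule of submod W by <:].
End Submodule.

Lemma cyclic_submod_closed (V : lmodType K) (v : V) :
  submod_closed [pred x : V | `[< exists r : K, x = r *: v >]].
Proof.
split=> [|a x y]; first by apply/asboolP; exists 0; rewrite scale0r.
move=> /asboolP[r ->] /asboolP[s ->]; apply/asboolP.
by exists (a * r + s); rewrite scalerDl scalerA.
Qed.

(** The submodule generated by one element. *)
Definition cyclic_submod (V : lmodType K) (v : V) : submodClosed V :=
  submodClosed_of (cyclic_submod_closed v).

Lemma cyclic_submodP (V : lmodType K) (v x : V) :
  reflect (exists r : K, x = r *: v) (x \in cyclic_submod v).
Proof. exact: asboolP. Qed.

Section Splitting.
Variables (A M : lmodType K).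

Lemma ext_proj_incl (E : extension A M) m : ext_proj E (ext_incl E m) = 0.
Proof. by apply/ext_exact; exists m. Qed.

(** Being equivalent to the split extension means having a retraction onto M. *)
Lemma Ext1_vanishesP :
  Ext1_vanishes A M <->
  forall E : extension A M, exists rho : {linear E -> M},
    forall m, rho (ext_incl E m) = m.
Proof.
split=> [AM E|retr E].
  have [phi [phiM phiA]] := AM E.
  have [|rho rhoE] := @linear_bundle E M (fun e => (phi e).1).
    by move=> a u v; rewrite linearP.
  by exists rho => m; rewrite rhoE phiM.
have [rho rhoM] := retr E.
have [|phi phiE] := @linear_bundle E (M * A)%type (fun e => (rho e, ext_proj E e)).
  by move=> a u v; rewrite !linearP.
exists phi; split=> [m|e]; rewrite phiE //=.
by rewrite rhoM ext_proj_incl.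
Qed.

(** A submodule N of E that the projection maps bijectively onto A is a complement
    of M. *)
Lemma complement_retraction (E : extension A M) (N : E -> Prop) :
    (forall a x y, N x -> N y -> N (a *: x + y)) ->
    (forall x, N x -> ext_proj E x = 0 -> x = 0) ->
    (forall a, exists2 x, N x & ext_proj E x = a) ->
  exists rho : {linear E -> M}, forall m, rho (ext_incl E m) = m.
Proof.
move=> Nlin N0 Nsurj.
have NB x y : N x -> N y -> N (y - x).
  by move=> Nx Ny; rewrite addrC -scaleN1r; apply: Nlin.
have /choice[f fP] e : exists m, N (e - ext_incl E m).
  have [x Nx xe] := Nsurj (ext_proj E e).
  have /ext_exact[m mE] : ext_proj E (e - x) = 0 by rewrite linearB /= xe subrr.
  by exists m; rewrite mE subKr.
(* N meets M trivially, so e determines the m with e - m in N. *)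
have funiq e m : N (e - ext_incl E m) -> f e = m.
  move=> Nem; apply/(@ext_incl_inj _ _ _ E)/eqP; rewrite -subr_eq0; apply/eqP.
  apply: N0; last by rewrite linearB /= !ext_proj_incl subrr.
  by have := NB _ _ (fP e) Nem; rewrite opprB addrC subrKA.
have [|rho rhoE] := @linear_bundle E M f.
  move=> a u v; apply: funiq.
  rewrite linearP /= opprD addrACA -scalerBr.
  by apply: Nlin; apply: fP.
exists rho => m; rewrite rhoE; apply: funiq.
have [x Nx _] := Nsurj 0.
by rewrite subrr -(subrr x); apply: NB.
Qed.

End Splitting.

(** If u generates a free submodule, then an extension of A by M, modulo the
    submodule generated by a preimage e0 of u, is an extension of A/(u) by M;
    a retraction of the latter composed with the projection retracts the
    former. *)
Lemma Ext1_vanishes_cyclic_quotient (A M : lmodType K) (u : A) :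
    (forall r, r *: u = 0 -> r = 0) ->
    Ext1_vanishes (quotmod (cyclic_submod u)) M ->
  Ext1_vanishes A M.
Proof.
move=> u_free /Ext1_vanishesP AuM; apply/Ext1_vanishesP => E.
set W := cyclic_submod u in AuM *.
have [e0 e0u] := ext_proj_surj E u.
pose W' := cyclic_submod e0.
have sW' x : x \in W' -> ext_proj E x \in W.
  by case/cyclic_submodP=> r ->; apply/cyclic_submodP; exists r; rewrite linearZ /= e0u.
pose pbar (x : quotmod W') : quotmod W := quotmod_class W (ext_proj E (repr x)).
have pbarE e : pbar (quotmod_class W' e) = quotmod_class W (ext_proj E e).
  apply/quotmod_class_eqP; rewrite -linearB; apply: sW'.
  by apply/quotmod_class_eqP; rewrite quotmod_class_repr.
have [|pi' pi'E] := @linear_bundle _ _ pbar.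
  move=> a x y; rewrite -[x]quotmod_class_repr -[y]quotmod_class_repr.
  by rewrite -linearP !pbarE !linearP.
have [|i' i'E] := @linear_bundle M _ (fun m => quotmod_class W' (ext_incl E m)).
  by move=> a x y; rewrite !linearP.
have i'inj : injective i'.
  move=> m m'; rewrite !i'E => /quotmod_class_eqP/cyclic_submodP[r].
  rewrite -linearB => mE; apply/eqP; rewrite -subr_eq0; apply/eqP.
  apply/(@ext_incl_inj _ _ _ E); rewrite raddf0 mE.
  have := congr1 (ext_proj E) mE; rewrite ext_proj_incl linearZ /= e0u.
  by move/esym/u_free ->; rewrite scale0r.
have pi'surj a : exists e, pi' e = a.
  have [e eE] := ext_proj_surj E (repr a).
  by exists (quotmod_class W' e); rewrite pi'E pbarE eE quotmod_class_repr.
have exact' x : pi' x = 0 <-> exists m, i' m = x.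
  split=> [|[m <-]]; last by rewrite i'E pi'E pbarE ext_proj_incl raddf0.
  rewrite -[x]quotmod_class_repr pi'E pbarE -(raddf0 (quotmod_class W)).
  move/quotmod_class_eqP; rewrite subr0 => /cyclic_submodP[r rE].
  have /ext_exact[m mE] : ext_proj E (repr x - r *: e0) = 0.
    by rewrite linearB linearZ /= e0u rE subrr.
  exists m; rewrite i'E; apply/esym/quotmod_class_eqP.
  by rewrite mE subKr; apply/cyclic_submodP; exists r.
have [rho rhoM] := AuM (Extension i'inj pi'surj exact').
have [|rho' rho'E] := @linear_bundle E M (fun e => rho (quotmod_class W' e)).
  by move=> a x y; rewrite !linearP.
by exists rho' => m; rewrite rho'E -[RHS]rhoM /= i'E.
Qed.

End Modules.

(** * Torsion-free divisible modules are strongly flat *)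

(** The right action of r on v. *)
Local Notation "v *| r" := (@GRing.scale _^c _ r v) (at level 40, left associativity).

(** D has no nonzero torsion: v r = 0 with r <> 0 forces v = 0. *)
Definition torsion_free (R : nzRingType) (D : right_module R) : Prop :=
  forall (r : R) (v : D), r <> 0 -> v *| r = 0 -> v = 0.

(** D r = D for every nonzero r. *)
Definition divisible (R : nzRingType) (D : right_module R) : Prop :=
  forall (r : R) (v : D), r <> 0 -> exists w, w *| r = v.

Lemma rscaleA (R : nzRingType) (D : right_module R) (v : D) (r s : R) :
  v *| r *| s = v *| (r * s).
Proof. exact: scalerA. Qed.

Lemma torsion_free_cancel (R : nzRingType) (D : right_module R) (r : R) (v w : D) :
  torsion_free D -> r <> 0 -> v *| r = w *| r -> v = w.
Proof.
move=> tfD r0 vw; apply/eqP; rewrite -subr_eq0; apply/eqP/(tfD r) => //.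
by rewrite scalerBr vw subrr.
Qed.

Section TorsionFreeDivisible.
Variables (R : nzRingType) (R_Ore : right_Ore_domain R).
Variables (Q : unitRingType) (iota : {rmorphism R -> Q}).
Hypothesis Q_quot : classical_right_quotient_ring iota.
Variable D : right_module R.
Hypothesis D_tf : torsion_free D.
Hypothesis D_div : divisible D.

Local Notation QR := (as_right_module iota).

Let iota_inj : injective iota. Proof. by case: Q_quot. Qed.

Let iota_unit s : s <> 0 -> iota s \is a GRing.unit.
Proof. by case: Q_quot => _ + _; apply. Qed.

(** The relation x = d q for d, x in D and q in Q, stated without division: for
    every way of writing q s = a with s, a in R, one has x s = d a. *)
Definition is_dq (d : D) (q : Q) (x : D) : Prop :=
  forall s a : R, q * iota s = iota a -> x *| s = d *| a.

Lemma fraction_ex (q : Q) : exists a s : R, s <> 0 /\ q * iota s = iota a.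
Proof.
have [_ _ /(_ q)[a [s [s0 ->]]]] := Q_quot.
by exists a, s; split=> //; rewrite mulrVK ?iota_unit.
Qed.

(** One expression of q as a fraction suffices. *)
Lemma is_dq_fraction d q x (s a : R) :
  s <> 0 -> q * iota s = iota a -> x *| s = d *| a -> is_dq d q x.
Proof.
move=> s0 qs xs s' a' qs'.
have [_ [_ _ Ore]] := R_Ore; have [u [v [v0 uv]]] := Ore s' s s0.
(* s' u = s v brings the two fractions to a common denominator. *)
apply: (torsion_free_cancel D_tf v0).
rewrite !rscaleA uv -rscaleA xs rscaleA; congr (_ *| _).
by apply: iota_inj; rewrite !rmorphM -qs -qs' -!mulrA -!rmorphM uv.
Qed.

Lemma is_dq_linear d (r : R) q q' x x' :
  is_dq d q x -> is_dq d q' x' -> is_dq d (q * iota r + q') (x *| r + x').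
Proof.
move=> qx qx' s a qs.
have [b [t [t0 qt]]] := fraction_ex (q * iota (r * s)).
apply: (torsion_free_cancel D_tf t0).
have xb := qx (r * s * t) b; rewrite rmorphM mulrA in xb.
have xb' := qx' (s * t) (a * t - b).
rewrite !scalerDr !rscaleA mulrA xb // xb'.
  by rewrite scalerBl; exact: subrKC.
rewrite rmorphB -qt !rmorphM -qs mulrDl mulrDl -!mulrA.
by rewrite addrC addKr.
Qed.

Lemma is_dq0 d : is_dq d 0 0.
Proof.
by move=> s a; rewrite mul0r -(rmorph0 iota) => /iota_inj<-; rewrite scaler0 scale0r.
Qed.

Lemma is_dq0_eq0 d x : is_dq d 0 x -> x = 0.
Proof.
by move/(_ 1 0); rewrite mul0r rmorph0 => /(_ erefl); rewrite scale1r scale0r.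
Qed.

Lemma is_dq_ex d q : exists x, is_dq d q x.
Proof.
have [a [s [s0 qs]]] := fraction_ex q.
by have [x xs] := D_div (d *| a) s0; exists x; apply: is_dq_fraction qs xs.
Qed.

Section Lift.
Variables (M : right_module R) (E : extension D M) (d : D).

Lemma pullback_submod_closed :
  submod_closed [pred z : (QR * E)%type | `[< is_dq d z.1 (ext_proj E z.2) >]].
Proof.
split=> [|r z z' /asboolP zP /asboolP z'P].
  by apply/asboolP; rewrite /= raddf0; exact: is_dq0.
by apply/asboolP; rewrite /= linearP; exact: (is_dq_linear zP z'P).
Qed.

(** The pullback of E -> D along the map q |-> d q from Q to D. *)
Definition pullback_pred : submodClosed (QR * E)%type :=
  submodClosed_of pullback_submod_closed.

Lemma pullbackP (z : (QR * E)%type) :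
  reflect (is_dq d z.1 (ext_proj E z.2)) (z \in pullback_pred).
Proof. exact: asboolP. Qed.

(** When M is Matlis-cotorsion, q |-> d q lifts to a linear map Q -> E. *)
Lemma lift_rank1 : Matlis_cotorsion iota M ->
  exists h : {linear QR -> E}, forall q, is_dq d q (ext_proj E (h q)).
Proof.
move=> /Ext1_vanishesP cM; pose pullback := submod pullback_pred.
have pullP (q : QR) e : is_dq d q (ext_proj E e) -> exists z : pullback, val z = (q, e).
  move=> qe; have /pullbackP z : is_dq d (q, e).1 (ext_proj E (q, e).2) := qe.
  by exists (Submod z).
have dqP (z : pullback) : is_dq d (val z).1 (ext_proj E (val z).2).
  by apply/pullbackP; exact: (valP z).
have /choice[f fP] (m : M) : exists z : pullback, val z = (0, ext_incl E m).
  by apply: pullP; rewrite ext_proj_incl; exact: is_dq0.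
have [|i iE] := @linear_bundle _ M pullback f.
  move=> a m m'; apply: val_inj; rewrite linearP /= !fP linearP.
  by congr pair; rewrite /= scaler0 addr0.
have [|p pE] := @linear_bundle _ pullback QR (fun z => (val z).1).
  by move=> a z z'; rewrite linearP.
have i_inj : injective i.
  move=> m m' /(congr1 val); rewrite !iE !fP => -[].
  exact: ext_incl_inj.
have p_surj q : exists z, p z = q.
  have [x qx] := is_dq_ex d q; have [e ex] := ext_proj_surj E x.
  have [z zE] := pullP q e ltac:(by rewrite ex).
  by exists z; rewrite pE zE.
have ip_exact z : p z = 0 <-> exists m, i m = z.
  split=> [|[m <-]]; last by rewrite iE pE fP.
  rewrite pE => z0; have := dqP z; rewrite z0 => /is_dq0_eq0/ext_exact[m mE].
  by exists m; apply: val_inj; rewrite iE fP mE -z0 -surjective_pairing.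
have [rho rhoM] := cM (Extension i_inj p_surj ip_exact).
(* The section with values in ker rho: subtract the M-component. *)
have /choice[g gP] (q : QR) : exists z : pullback, p z = q /\ rho z = 0.
  have [z zq] := p_surj q; exists (z - i (rho z)); split.
    by rewrite linearB zq (ip_exact _).2 ?subr0 //; exists (rho z).
  by rewrite linearB [rho (i _)]rhoM subrr.
have [|h hE] := @linear_bundle _ QR E (fun q => (val (g q)).2).
  move=> a q q'; suff -> : g ((q : QR) *| a + q') = a *: g q + g q' by rewrite linearP.
  apply/eqP; rewrite -subr_eq0; apply/eqP; set z := _ - _.
  have /ip_exact[m mE] : p z = 0.
    by rewrite linearB linearP !(gP _).1 subrr.
  have : rho z = 0 by rewrite linearB linearP !(gP _).2 scaler0 addr0 subrr.
  by rewrite -mE [rho _]rhoM => ->; rewrite raddf0.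
exists h => q; rewrite hE; have := dqP (g q).
by rewrite -pE (gP q).1.
Qed.

End Lift.

Lemma torsion_free_divisible_strongly_flat : strongly_flat iota D.
Proof.
move=> M cM; apply/Ext1_vanishesP => E; set p := ext_proj E.
(* The candidates for a complement.  The empty set is allowed here, so that every
   chain has its union as an upper bound; a maximal candidate contains 0.  The
   third clause says that p N is closed under division by nonzero elements. *)
pose good (N : set E) := [/\ forall (a : R) x y, N x -> N y -> N (x *| a + y),
  forall x, N x -> p x = 0 -> x = 0
  & forall (r : R) x n, r <> 0 -> N n -> p x *| r = p n ->
      exists2 n', N n' & p n' = p x].
have [|N [[Nlin Ninj Npure] Nmax]] := @Zorn_bigcup E good.
  move=> F Fgood Ftot.
  split=> [a x y [X FX Xx] [Y FY Yy]|x [X FX Xx]|r x n r0 [X FX Xn] xr].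
  - have [XY|YX] := Ftot _ _ FX FY.
      by exists Y => //; have [Ylin _ _] := Fgood _ FY; apply: Ylin => //; exact: XY.
    by exists X => //; have [Xlin _ _] := Fgood _ FX; apply: Xlin => //; exact: YX.
  - by have [_ Xinj _] := Fgood _ FX; exact: Xinj.
  - have [_ _ Xpure] := Fgood _ FX; have [n' Xn' n'x] := Xpure _ _ _ r0 Xn xr.
    by exists n' => //; exists X.
have N0 : N 0.
  apply: contrapT => nN0; apply: (Nmax [set (0 : E)]%classic).
    split=> [x Nx|/(_ 0 erefl)//]; case: nN0.
    by rewrite -(addNr x) -scaleN1r; exact: Nlin.
  split=> [a x y -> ->|x ->//|r x n r0 ->].
    by rewrite scaler0 addr0.
  rewrite raddf0 => /(D_tf r0) px0; exists 0 => //.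
  by rewrite raddf0 px0.
have NZ (a : R) x : N x -> N (x *| a) by move=> Nx; rewrite -[_ *: _]addr0; exact: Nlin.
suff Nsurj d : exists2 x, N x & p x = d.
  by exact: (complement_retraction (E := E) (N := N) Nlin Ninj Nsurj).
apply: contrapT => nd.
have [h hd] := lift_rank1 E d cM.
have ph1 : p (h 1) = d.
  by have := hd 1 1 1; rewrite rmorph1 mulr1 !scale1r; apply.
pose N' : set E := [set e | exists n q, N n /\ e = n + h q]%classic.
(* N' is N + h(Q), strictly larger than N since p (h 1) = d is not in p N. *)
apply: (Nmax N'); first split=> [x Nx|sN'].
- by exists x, 0; rewrite raddf0 addr0.
- apply: nd; exists (h 1) => //; apply: sN'.
  by exists 0, 1; rewrite add0r.
split.
- move=> a _ _ [n [q [Nn ->]]] [n' [q' [Nn' ->]]].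
  exists (n *| a + n'), ((q : QR) *| a + q'); split; first exact: Nlin.
  by rewrite scalerDr linearP addrACA.
- move=> _ [n [q [Nn ->]]]; rewrite raddfD => /= pnq.
  have [a [s [s0 qs]]] := fraction_ex q.
  have da : p (h q) *| s = d *| a by exact: hd.
  have [a0|a0] := pselect (a = 0).
    have q0 : q = 0.
      by rewrite -[LHS](mulrK (iota_unit s0) (q : Q)) qs a0 rmorph0 mul0r.
    by move: pnq; rewrite q0 !raddf0 !addr0; exact: Ninj.
  (* Here d a lies in p N and a <> 0, hence d lies in p N. *)
  have [||n' Nn' n'd] := Npure a (h 1) (n *| (- s)) a0; first exact: NZ.
    by rewrite ph1 -da linearZ /= scaleNr -scalerN (addr0_eq pnq).
  by case: nd; exists n'; rewrite // n'd ph1.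
- move=> r x _ r0 [n [q [Nn ->]]]; rewrite raddfD => /= xr.
  have [w wr] := D_div (p n) r0; have [e ew] := ext_proj_surj E w.
  have [|n1 Nn1 n1e] := Npure r e n r0 Nn; first by rewrite [p e]ew.
  pose q1 : QR := (q : Q) * (iota r)^-1.
  have q1r : (q1 : QR) *| r = q by rewrite -[LHS]/(_ * _ * _) mulrVK ?iota_unit.
  exists (n1 + h q1); first by exists n1, q1.
  apply/esym/(torsion_free_cancel D_tf r0).
  rewrite raddfD /= scalerDr n1e [p e]ew wr -[p (h q1) *| r]linearZ /=.
  by rewrite -[h q1 *| r]linearZ /= q1r.
Qed.

End TorsionFreeDivisible.

(** * The completion of a domain *)

Section Completion.
Variables (R : nzRingType) (R_dom : domain R).
Implicit Types (F G : finite_index R) (x y : completion R).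

Local Notation U := (@U R).

Let cancelr (r a b : R) : r <> 0 -> a * r = b * r -> a = b.
Proof.
move=> r0 /eqP; rewrite -subr_eq0 -mulrBl => /eqP/R_dom[/eqP|//].
by rewrite subr_eq0 => /eqP.
Qed.

Lemma UP (F : {fset R}) (x : R) :
  reflect (forall r s : R, s \in F -> exists t : R, x * r = t * s) (x \in U F).
Proof. exact: asboolP. Qed.

(** U F is also a left ideal. *)
Lemma U_mull (F : {fset R}) (w x : R) : x \in U F -> w * x \in U F.
Proof.
move=> /UP Ux; apply/UP => r s /(Ux r)[t xt].
by exists (w * t); rewrite -!mulrA xt.
Qed.

Lemma U_mulr (F : {fset R}) (x a : R) : x \in U F -> x * a \in U F.
Proof. exact: (rpredZ (a : R^c)). Qed.

Lemma U_mem_multiple F (x s : R) :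
  s \in val F -> x \in U (val F) -> exists t, x = t * s.
Proof. by move=> Fs /UP/(_ 1 s Fs); rewrite mulr1. Qed.

Lemma UD (F : {fset R}) (x y : R) : x \in U F -> y \in U F -> x + y \in U F.
Proof. exact: rpredD. Qed.

Lemma UB (F : {fset R}) (x y : R) : x \in U F -> y \in U F -> x - y \in U F.
Proof. exact: rpredB. Qed.

Lemma finite_index1_subproof (r : R) : r <> 0 ->
  ([fset r] != fset0)%fset && (0 \notin [fset r])%fset.
Proof.
move=> r0; apply/andP; split; first by apply/fset0Pn; exists r; rewrite in_fset1.
by rewrite in_fset1 eq_sym; apply/eqP.
Qed.

(** The index {r}. *)
Definition finite_index1 (r : R) (r0 : r <> 0) : finite_index R :=
  exist _ [fset r]%fset (finite_index1_subproof r0).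

Lemma finite_indexU_subproof F G :
  (val F `|` val G != fset0)%fset && (0 \notin val F `|` val G)%fset.
Proof.
have /andP[/fset0Pn[s Fs] F0] := valP F; have /andP[_ G0] := valP G.
rewrite in_fsetU negb_or F0 G0 !andbT; apply/fset0Pn; exists s.
by rewrite in_fsetU Fs.
Qed.

(** The union of two indices. *)
Definition finite_indexU F G : finite_index R :=
  exist _ (val F `|` val G)%fset (finite_indexU_subproof F G).

(** A representative in R of the component of x in R / U F. *)
Definition crepr x F : R := repr (val x F).

Lemma crepr_class x F :
  quotmod_class [the submodClosed R^c^o of U (val F)] (crepr x F) = val x F.
Proof. exact: quotmod_class_repr. Qed.

Lemma crepr_coherent x F G : (val F `<=` val G)%fset ->
  crepr x G - crepr x F \in U (val F).
Proof.
move=> sFG; have /asboolP/(_ F G sFG) := valP x.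
by rewrite -[RHS]crepr_class /R_mod_U_trans => /quotmod_class_eqP.
Qed.

Lemma completion_eq x y : (forall F, crepr x F - crepr y F \in U (val F)) -> x = y.
Proof.
move=> xy; apply/val_inj/functional_extensionality_dep => F.
by rewrite -!crepr_class; apply/quotmod_class_eqP.
Qed.

(** A coherent family of elements of R defines an element of the completion. *)
Lemma completion_ex (c : finite_index R -> R) :
    (forall F G, (val F `<=` val G)%fset -> c G - c F \in U (val F)) ->
  exists x, forall F, crepr x F - c F \in U (val F).
Proof.
move=> c_coh.
pose x : prodmod (@R_mod_U R) :=
  fun F => quotmod_class [the submodClosed R^c^o of U (val F)] (c F).
have xP : x \in @coherent R.
  apply/asboolP => F G sFG; rewrite /R_mod_U_trans quotmod_trans_class.
    exact/quotmod_class_eqP/c_coh.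
  exact: U_anti.
by exists (Completion xP) => F; apply/quotmod_class_eqP; rewrite crepr_class.
Qed.

Lemma crepr_linear (a : R) x y F :
  crepr (x *| a + y) F - (crepr x F * a + crepr y F) \in U (val F).
Proof.
apply/quotmod_class_eqP; rewrite crepr_class linearP.
rewrite -[LHS]/((val x F : R_mod_U F) *| a + val y F).
by rewrite -[val x F]crepr_class -[val y F]crepr_class -linearP.
Qed.

Lemma crepr0 F : crepr 0 F \in U (val F).
Proof.
rewrite -[crepr 0 F]subr0; apply/quotmod_class_eqP.
by rewrite crepr_class !linear0.
Qed.

Lemma creprZ x (a : R) F : crepr (x *| a) F - crepr x F * a \in U (val F).
Proof.
have := UD (crepr_linear a x 0 F) (crepr0 F).
by rewrite addr0 opprD addrA subrK.
Qed.

Lemma completion_eq0 x : (forall F, crepr x F \in U (val F)) -> x = 0.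
Proof. by move=> x0; apply: completion_eq => F; apply/UB/crepr0. Qed.

Lemma subset_finite_indexUl F G : (val F `<=` val (finite_indexU F G))%fset.
Proof. exact: fsubsetUl. Qed.

Lemma subset_finite_indexUr F G : (val G `<=` val (finite_indexU F G))%fset.
Proof. exact: fsubsetUr. Qed.

Lemma U_trans F (a b c : R) :
  a - b \in U (val F) -> b - c \in U (val F) -> a - c \in U (val F).
Proof. by move=> ab /(UD ab); rewrite addrA subrK. Qed.

Lemma U_sym F (a b : R) : a - b \in U (val F) -> b - a \in U (val F).
Proof. by rewrite -[b - a]opprB rpredN. Qed.

(** The image u of 1, characterized by u a being the image of a in R. *)
Lemma completion_one_ex :
  exists u : completion R, forall (a : R) F, crepr (u *| a) F - a \in U (val F).
Proof.
have [|u uP] := @completion_ex (fun=> 1).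
  by move=> F G _; rewrite subrr; exact: rpred0.
exists u => a F; apply: U_trans (creprZ u a F) _.
by have := U_mulr a (uP F); rewrite mulrBl mul1r.
Qed.

(** The completion is torsion-free, and its quotient by the submodule generated
    by u is divisible and torsion-free. *)
Definition has_divisible_quotient (u : completion R) : Prop :=
  [/\ torsion_free (completion R : right_module R),
      forall (r : R) x, r <> 0 -> exists (a : R) y, x = u *| a + y *| r
    & forall (r a : R) x, r <> 0 -> x *| r = u *| a -> exists b : R, x = u *| b].

(** ** The discrete case: some U F0 is zero *)

Section Discrete.
Variable u : completion R.
Hypothesis uE : forall (a : R) F, crepr (u *| a) F - a \in U (val F).
Variable F0 : finite_index R.
Hypothesis UF0 : forall a : R, a \in U (val F0) -> a = 0.

Lemma discrete_generated x : x = u *| (crepr x F0).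
Proof.
apply: completion_eq => F; have cF := crepr_coherent x (subset_finite_indexUl F F0).
have /UF0/eqP := crepr_coherent x (subset_finite_indexUr F F0).
rewrite subr_eq0 => /eqP <-; apply: U_sym.
exact: U_trans (uE _ _) cF.
Qed.

Lemma discrete_has_divisible_quotient : has_divisible_quotient u.
Proof.
split=> [r x r0|r x r0|r a x r0 _].
- rewrite (discrete_generated x) rscaleA => xr.
  have := UB (crepr0 F0) (uE (crepr x F0 * r) F0).
  rewrite xr opprB addrC subrK => /UF0/R_dom[->|//].
  by rewrite scale0r.
- by exists (crepr x F0), 0; rewrite scaler0 addr0 -discrete_generated.
- by exists (crepr x F0); exact: discrete_generated.
Qed.

End Discrete.

(** ** The case where every U F is nonzero *)

Section Bounded.
Variable u : completion R.
Hypothesis uE : forall (a : R) F, crepr (u *| a) F - a \in U (val F).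
Hypothesis U_neq0 : forall F, exists2 a : R, a \in U (val F) & a <> 0.

(** U G is contained in (U F) r for some G containing F and r. *)
Lemma U_mul_refine F (r : R) : r <> 0 -> exists G,
  [/\ (val F `<=` val G)%fset, r \in val G
    & forall y : R, y \in U (val G) -> exists2 z : R, z \in U (val F) & y = z * r].
Proof.
move=> r0; have [t Ut t0] := U_neq0 F.
have tr0 : t * r <> 0 by move/R_dom => [].
exists (finite_indexU F (finite_indexU (finite_index1 r0) (finite_index1 tr0))).
split=> [||y Uy].
- exact: subset_finite_indexUl.
- by rewrite /= !in_fsetU in_fset1 eqxx orbT.
- have [|w ->] := U_mem_multiple (s := t * r) _ Uy.
    by rewrite /= !in_fsetU !in_fset1 eqxx !orbT.
  by exists (w * t); [exact: U_mull|rewrite mulrA].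
Qed.

Lemma bounded_torsion_free : torsion_free (completion R : right_module R).
Proof.
move=> r x r0 xr; apply: completion_eq0 => F.
have [G [sFG _ UG]] := U_mul_refine F r0.
have := UB (crepr0 G) (creprZ x r G); rewrite xr opprB addrC subrK.
case/UG=> z Uz /(cancelr r0) xz.
have := crepr_coherent x sFG; rewrite xz => /(UB Uz).
by rewrite subKr.
Qed.

Lemma bounded_divisible (r : R) x : r <> 0 ->
  exists (a : R) y, x = u *| a + y *| r.
Proof.
move=> r0; pose a := crepr x (finite_index1 r0).
have /choice[g gP] F := U_mul_refine F r0.
(* c F is the component of (x - u a) / r modulo U F; it is computed modulo U (g F),
   which is contained in (U F) r. *)
have /choice[c cP] F : exists z, crepr x (g F) - a = z * r.
  have [_ rG _] := gP F.
  have /(U_mem_multiple (s := r)) : crepr x (g F) - a \in U (val (finite_index1 r0)).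
    by apply: crepr_coherent; rewrite fsub1set.
  by apply; rewrite in_fset1.
have c_coh F G : (val F `<=` val G)%fset -> c G - c F \in U (val F).
  move=> sFG; have [_ _ UF] := gP F; have [_ _ UG] := gP G.
  have [z Uz zE] := UF _ (crepr_coherent x (subset_finite_indexUl (g F) (g G))).
  have [w Uw wE] := UG _ (crepr_coherent x (subset_finite_indexUr (g F) (g G))).
  have -> : c G - c F = z - w.
    apply: (cancelr r0); rewrite !mulrBl -!cP -zE -wE.
    by rewrite opprB addrA subrK opprB [RHS]addrC addrA subrK.
  by apply: UB => //; exact: U_anti Uw.
have [y yE] := completion_ex c_coh.
exists a, y; apply: completion_eq => F; have [sFG _ _] := gP F.
have yr : crepr (y *| r) F - c F * r \in U (val F).
  apply: U_trans (creprZ y r F) _; rewrite -mulrBl.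
  exact: U_mulr (yE F).
apply: U_sym.
have := crepr_linear 1 (u *| a) (y *| r) F; rewrite scale1r mulr1 => /U_trans; apply.
have := UD (UD (uE a F) yr) (crepr_coherent x sFG).
rewrite -cP.
suff -> : forall p q s t v : R, p - s + (q - (t - s)) + (t - v) = p + q - v by [].
move=> p q s t v; rewrite opprB -addrA -[q + _ + _]addrA subrKA.
by rewrite [q + _]addrCA subrKA addrA.
Qed.

Lemma bounded_pure (r a : R) x : r <> 0 -> x *| r = u *| a -> exists b : R, x = u *| b.
Proof.
move=> r0 xr; pose F := finite_index1 r0.
have : a - crepr x F * r \in U (val F).
  by apply: U_trans (U_sym (uE a F)) _; rewrite -xr; exact: creprZ.
case/(U_mem_multiple (s := r)); first by rewrite in_fset1.
move=> t /(canRL (subrK _)); rewrite -mulrDl => aE.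
exists (t + crepr x F); apply: (torsion_free_cancel bounded_torsion_free r0).
by rewrite rscaleA -aE.
Qed.

End Bounded.

Lemma completion_has_divisible_quotient : exists u, has_divisible_quotient u.
Proof.
have [u uE] := completion_one_ex; exists u.
have [[F0 UF0]|nF0] := pselect (exists F, forall a : R, a \in U (val F) -> a = 0).
  exact: discrete_has_divisible_quotient UF0.
have U_neq0 F : exists2 a : R, a \in U (val F) & a <> 0.
  apply: contrapT => nF; apply: nF0; exists F => a Ua; apply: contrapT => a0.
  by apply: nF; exists a.
split; [exact: bounded_torsion_free|exact: bounded_divisible|exact: bounded_pure].
Qed.

End Completion.

(** * Strong flatness of the completion *)

Theorem theorem4p9 (R : nzRingType) (R_Ore : right_Ore_domain R)
    (Q : unitRingType) (iota : {rmorphism R -> Q})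
    (Q_quot : classical_right_quotient_ring iota) :
  strongly_flat iota (completion R).
Proof.
have [u [tfA divA pureA]] := completion_has_divisible_quotient R_Ore.1.
have [u0|u0] := pselect (u = 0).
  apply: (torsion_free_divisible_strongly_flat R_Ore Q_quot) => // r x r0.
  have [a [y ->]] := divA r x r0.
  by exists y; rewrite u0 scaler0 add0r.
move=> M cM; apply: (Ext1_vanishes_cyclic_quotient (u := u)).
  by move=> r ur; apply: contrapT => r0; apply: u0; exact: tfA ur.
apply: (torsion_free_divisible_strongly_flat R_Ore Q_quot) cM => r x r0.
  rewrite -[x]quotmod_class_repr -linearZ -(raddf0 (quotmod_class _)).
  move=> /quotmod_class_eqP; rewrite subr0.
  move=> /cyclic_submodP[a /(pureA _ _ _ r0)[b xb]].
  by apply/quotmod_class_eqP; rewrite subr0; apply/cyclic_submodP; exists b.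
have [a [y xE]] := divA r (repr x) r0.
exists (quotmod_class _ y); rewrite -linearZ -[RHS]quotmod_class_repr.
apply/quotmod_class_eqP; rewrite xE opprD addrCA subrr addr0.
by apply/cyclic_submodP; exists (- a : R); rewrite scaleNr.
Qed.
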